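(* Let $n\ge1$, let $1<p_i<\infty$ and $p_i'=p_i/(p_i-1)$ for $i=1,2,3$, and let $\alpha_1,\alpha_2,\alpha_3,\alpha_{12},\alpha_{13},\alpha_{23}$ be real numbers (with $\alpha_{ji}=\alpha_{ij}$) satisfying all of the following: \begin{itemize} \item $\frac1{p_1}+\frac1{p_2}+\frac1{p_3}+\frac{\alpha_1+\alpha_2+\alpha_3+\alpha_{12}+\alpha_{13}+\alpha_{23}}{n}=3$; \item $\alpha_1+\alpha_2+\alpha_3\ge 0$; \item $\alpha_{ij}<n$ for $i\ne j$; \item $\alpha_i<\frac{n}{p_i'}$ for $i=1,2,3$; \item $\alpha_i+\sum_{j\ne i}\alpha_{ij}>\frac{n}{p_i'}$ for $i=1,2,3$; \item $\alpha_{12}+\alpha_{13}+\alpha_{23}<2n$; \item $\frac1{p_1}+\frac1{p_2}+\frac1{p_3}\ge 1$. \end{itemize} Let $f_i\in L^{p_i}(\mathbb R^n)$, $i=1,2,3$, be nonnegative functions such that $\|f_i\|_{L^{p_i}(\mathbb R^n)}=1$ for $i=1,2,3$ and $\Lambda_A(f_1,f_2,f_3)=C_A(p_1,p_2,p_3)$. Then $(f_1,f_2,f_3)$ satisfies the following system almost everywhere: \begin{align*} C_A(p_1,p_2,p_3)f_1(x_1)^{p_1-1}&=\iint_{\mathbb R^n\times\mathbb R^n}K_A(x_1,x_2,x_3)f_2(x_2)f_3(x_3)\,dx_2\,dx_3,\\ C_A(p_1,p_2,p_3)f_2(x_2)^{p_2-1}&=\iint_{\mathbb R^n\times\mathbb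 R^n}K_A(x_1,x_2,x_3)f_1(x_1)f_3(x_3)\,dx_1\,dx_3,\\ C_A(p_1,p_2,p_3)f_3(x_3)^{p_3-1}&=\iint_{\mathbb R^n\times\mathbb R^n}K_A(x_1,x_2,x_3)f_1(x_1)f_2(x_2)\,dx_1\,dx_2. \end{align*}
   Context: The kernel is $K_A(x_1,x_2,x_3)=\prod_{i=1}^3|x_i|^{-\alpha_i}\prod_{1\le i<j\le3}|x_i-x_j|^{-\alpha_{ij}}$, the trilinear form is $$\Lambda_A(f_1,f_2,f_3)=\iiint_{(\mathbb R^n)^3}K_A(x_1,x_2,x_3)f_1(x_1)f_2(x_2)f_3(x_3)\,dx_1dx_2dx_3 ,$$ and $C_A(p_1,p_2,p_3)=\sup_{\|f_i\|_{L^{p_i}(\mathbb R^n)}=1,\ i=1,2,3}|\Lambda_A(f_1,f_2,f_3)|$. It is a known theorem that, for $1<p_i<\infty$, the listed conditions are necessary and sufficient for the existence of a finite $C$ with $|\Lambda_A(f_1,f_2,f_3)|\le C\prod_i\|f_i\|_{L^{p_i}(\mathbb R^n)}$ for all $f_i\in L^{p_i}(\mathbb R^n)$.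
   Formalization: The formal theorem additionally assumes that the trilinear form is bounded on L^{p_1}×L^{p_2}×L^{p_3} (so C_A is finite); the listed conditions alone do not imply this, e.g. when α_12 > n/p_1' + n/p_2'. *)

(* Defs.v *)
From HB Require Import structures.
From mathcomp Require Import all_boot all_order all_algebra.
From mathcomp Require Import all_classical all_reals all_analysis.

Set Implicit Arguments.
Unset Strict Implicit.
Unset Printing Implicit Defensive.
Import Order.TTheory GRing.Theory Num.Theory.
Import numFieldNormedType.Exports.

Local Open Scope classical_set_scope.
Local Open Scope ring_scope.

(* The library's sigma-finite structure on m1 \x m2 is masked by the one it
   declares for subprobabilities, so sigma-finiteness is reproved here. *)
Lemma product_measure_sigma_finite d1 d2
    (T1 : measurableType d1) (T2 : measurableType d2) (R : realType)
    (m1 : {sigma_finite_measure set T1 -> \bar R})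
    (m2 : {sigma_finite_measure set T2 -> \bar R}) :
  sigma_finite setT (m1 \x m2)%E.
Proof.
have /sigma_finiteP[F [TF ndF Foo]] := sigma_finiteT m1.
have /sigma_finiteP[G [TG ndG Goo]] := sigma_finiteT m2.
exists (fun n => F n `*` G n).
  rewrite -setXTT TF TG predeqE => -[x y]; split.
    move=> [/= [n _ Fnx] [k _ Gky]]; exists (maxn n k) => //; split.
    - by move: x Fnx; exact/subsetPset/ndF/leq_maxl.
    - by move: y Gky; exact/subsetPset/ndG/leq_maxr.
  by move=> [n _ []/= ? ?]; split; exists n.
move=> k; have [? ?] := Foo k; have [? ?] := Goo k.
split; first exact: measurableX.
by rewrite product_measure1E// lte_mul_pinfty// ge0_fin_numE.
Qed.

(* R^n as the n-fold product of the line; the canonical sigma-algebra on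
   tuples is generated by the coordinate maps, so it is the Borel one. *)
Notation Rn R n := (n.-tuple (measurableTypeR R)).

Section lebesgue_measure_Rn.
Variable R : realType.

Definition cons_Rn n (z : measurableTypeR R * Rn R n) : Rn R n.+1 :=
  [the n.+1.-tuple (measurableTypeR R) of z.1 :: z.2].

Lemma measurable_cons_Rn n : measurable_fun setT (@cons_Rn n).
Proof. by apply: measurable_cons. Qed.

Definition uncons_Rn n (x : Rn R n.+1) : measurableTypeR R * Rn R n :=
  (thead x, [tuple of behead x]).

Lemma measurable_uncons_Rn n : measurable_fun setT (@uncons_Rn n).
Proof.
apply: measurable_fun_pair; last exact: measurable_behead.
exact: measurable_tnth.
Qed.

Lemma uncons_RnK n : cancel (@cons_Rn n) (@uncons_Rn n).
Proof. by move=> [a x]; congr pair; apply: val_inj. Qed.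

Lemma cons_RnK n : cancel (@uncons_Rn n) (@cons_Rn n).
Proof. by move=> x; rewrite [RHS]tuple_eta; apply: val_inj. Qed.

Section succ.
Variables (n : nat) (mu : {sigma_finite_measure set (Rn R n) -> \bar R}).

Definition lebesgue_succ : set (Rn R n.+1) -> \bar R :=
  pushforward (@lebesgue_measure R \x mu)%E (@cons_Rn n).

Let lebesgue_succ0 : lebesgue_succ set0 = 0%E.
Proof. by rewrite /lebesgue_succ /pushforward preimage_set0 measure0. Qed.

Let lebesgue_succ_ge0 A : (0 <= lebesgue_succ A)%E.
Proof. by rewrite /lebesgue_succ /pushforward measure_ge0. Qed.

Let lebesgue_succ_sigma_additive : semi_sigma_additive lebesgue_succ.
Proof.
move=> F mF tF mUF; rewrite /lebesgue_succ /pushforward preimage_bigcup.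
apply: measure_semi_sigma_additive.
- by move=> k; rewrite -[X in measurable X]setTI; exact: measurable_cons_Rn.
- apply/trivIsetP => /= i j _ _ ij; rewrite -preimage_setI.
  by move/trivIsetP : tF => /(_ _ _ _ _ ij) ->//; rewrite preimage_set0.
- rewrite -preimage_bigcup -[X in measurable X]setTI.
  exact: measurable_cons_Rn.
Qed.

HB.instance Definition _ := isMeasure.Build _ _ _ lebesgue_succ
  lebesgue_succ0 lebesgue_succ_ge0 lebesgue_succ_sigma_additive.

Let lebesgue_succ_sigma_finite : sigma_finite setT lebesgue_succ.
Proof.
have [F TF Foo] :=
  product_measure_sigma_finite (@lebesgue_measure R) mu.
exists (fun k => @uncons_Rn n @^-1` F k).
  by rewrite -preimage_bigcup -TF preimage_setT.
move=> k; have [mF Fk] := Foo k; split.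
  by rewrite -[X in measurable X]setTI; exact: measurable_uncons_Rn.
rewrite /lebesgue_succ /pushforward -comp_preimage.
rewrite (_ : _ \o _ = id) ?preimage_id//.
by apply/funext => z /=; exact: uncons_RnK.
Qed.

HB.instance Definition _ := @Measure_isSigmaFinite.Build _ _ _ lebesgue_succ
  lebesgue_succ_sigma_finite.

End succ.

Fixpoint lebesgue_Rn n : {sigma_finite_measure set (Rn R n) -> \bar R} :=
  if n is m.+1 then lebesgue_succ (lebesgue_Rn m) else \d_([tuple] : Rn R 0).

Lemma lebesgue_Rn_box n (A : 'I_n -> set (measurableTypeR R)) :
  (forall i, measurable (A i)) ->
  lebesgue_Rn n [set x | forall i, A i (tnth x i)] =
  (\prod_(i < n) lebesgue_measure (A i))%E.
Proof.
elim: n A => [|n IHn] A mA.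
  by rewrite big_ord0/= diracE mem_set// => -[].
rewrite big_ord_recl -IHn//= /lebesgue_succ /pushforward.
set B := [set x : Rn R n | forall i, A (lift ord0 i) (tnth x i)].
rewrite (_ : _ @^-1` _ = A ord0 `*` B).
  rewrite product_measure1E//.
  rewrite [X in measurable X](_ : _ = \bigcap_(i in [set: 'I_n])
      ((fun x : Rn R n => tnth x i) @^-1` A (lift ord0 i))); last first.
    by apply/seteqP; split => [x Bx i _|x Bx i]; [exact: Bx|exact: (Bx i I)].
  apply: fin_bigcap_measurable => // i _.
  by rewrite -[X in measurable X]setTI; exact: measurable_tnth.
apply/seteqP; split => -[a x] /=.
  move=> Ax; split=> [|i]; first by have := Ax ord0.
  by have := Ax (lift ord0 i); rewrite tnthS.
move=> [Aa Bx] i; case: (unliftP ord0 i) => [j ->|->//].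
by rewrite tnthS; exact: Bx.
Qed.

End lebesgue_measure_Rn.

Section trilinear_form.
Variable R : realType.

Record exponents := Exponents {
  alpha1 : R; alpha2 : R; alpha3 : R;
  alpha12 : R; alpha13 : R; alpha23 : R }.

Definition conj_exponent (p : R) : R := p / (p - 1).

Section fixed_dimension.
Variable n : nat.
Implicit Types x y : Rn R n.

Definition enorm x : R := Num.sqrt (\sum_(i < n) (tnth x i : R) ^+ 2).

Definition edist x y : R :=
  Num.sqrt (\sum_(i < n) ((tnth x i : R) - (tnth y i : R)) ^+ 2).

(* [powR] is total, with 0 `^ a = 0 for a != 0; hence a singular factor gets the
   value 0 where x_i = 0 or x_i = x_j, which is a null set when n > 0. *)
Definition kernel_fun (A : exponents) (x1 x2 x3 : Rn R n) : R :=
  enorm x1 `^ (- alpha1 A) * enorm x2 `^ (- alpha2 A) *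
  enorm x3 `^ (- alpha3 A) *
  (edist x1 x2 `^ (- alpha12 A) * edist x1 x3 `^ (- alpha13 A) *
   edist x2 x3 `^ (- alpha23 A)).

Local Notation mu := (lebesgue_Rn R n).

(* The variable of integration is z = ((x1, x2), x3). *)
Definition trilinear_form (A : exponents) (f1 f2 f3 : Rn R n -> R) : \bar R :=
  (\int[(mu \x mu) \x mu]_z
    (kernel_fun A z.1.1 z.1.2 z.2 * f1 z.1.1 * f2 z.1.2 * f3 z.2)%:E)%E.

(* Equivalent to best_constant being a real number rather than +oo. It does not
   follow from conditions that leave alpha12 > n / p1' + n / p2' possible: let
   f1, f2 concentrate near a common nonzero point and f3 live away from it. *)
Definition trilinear_bounded (A : exponents) (p1 p2 p3 : R) : Prop :=
  exists C : R, forall f1 f2 f3 : Rn R n -> R,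
    f1 \in Lfun mu p1%:E -> f2 \in Lfun mu p2%:E -> f3 \in Lfun mu p3%:E ->
    (`|trilinear_form A f1 f2 f3| <=
      C%:E * 'N[mu]_p1%:E[EFin \o f1] * 'N[mu]_p2%:E[EFin \o f2]
           * 'N[mu]_p3%:E[EFin \o f3])%E.

Definition best_constant (A : exponents) (p1 p2 p3 : R) : \bar R :=
  ereal_sup [set c | exists f1 f2 f3 : Rn R n -> R,
    [/\ f1 \in Lfun mu p1%:E, f2 \in Lfun mu p2%:E & f3 \in Lfun mu p3%:E] /\
    [/\ ('N[mu]_p1%:E[EFin \o f1] = 1)%E, ('N[mu]_p2%:E[EFin \o f2] = 1)%E,
        ('N[mu]_p3%:E[EFin \o f3] = 1)%E &
        c = `|trilinear_form A f1 f2 f3|%E]].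

End fixed_dimension.
End trilinear_form.

(* Main.v *)
Require Import Defs.
From HB Require Import structures.
From mathcomp Require Import all_boot all_order all_algebra.
From mathcomp Require Import all_classical all_reals all_analysis.
From mathcomp Require Import measurable_realfun ring lra.
Import Order.TTheory GRing.Theory Num.Theory.
Import numFieldNormedType.Exports.
Local Open Scope classical_set_scope.
Local Open Scope ring_scope.

(** Fix f2 and f3. As a functional of the first variable alone, the trilinear
    form is integration against the marginal
      g(x1) = double integral of K(x1, x2, x3) f2(x2) f3(x3) dx2 dx3,
    by Tonelli's theorem, and f1 maximises h |-> int h g among nonnegative h of
    unit L^p norm, with maximum c = C_A. So each of the three equations is an
    instance of one statement on a sigma-finite space ([extremizer_dual]): if f
    maximises int h g on the nonnegative unit sphere of L^p and c is the
    maximum, then c f^(p-1) = g almost everywhere.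

    That statement is a first-order condition, and since nothing is known
    a priori about g beyond g >= 0 (not even that it is finite), it is obtained
    by varying f upwards only. For F of finite measure and t > 0, the competitor
    h = f + t 1_F gives c + t int_F g <= c ||h||_p. Convexity of the p-th power
    bounds ||h||_p^p by 1 + p t u, with u = int_F (f + t)^(p-1), and Bernoulli's
    inequality bounds the latter by (1 + t u)^p; so int_F g is at most
    c int_F (f + t)^(p-1), with no limit taken in t ([integral_le_test]). As F
    is arbitrary, g <= c (f + t)^(p-1) almost everywhere
    ([ae_le_of_integral_le]); letting t run through 1 / (k + 1) yields
    g <= c f^(p-1). The reverse inequality is free: f g <= c f^p almost
    everywhere while both sides have integral c, so they agree almost
    everywhere, which settles the points where f > 0; where f = 0 the upper
    bound already forces g = 0.

    It remains that C_A is finite, which is what boundedness of the form says,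
    and that functions which are nonnegative only almost everywhere may be
    replaced by their absolute values: null sets of a factor lift to null sets
    of the product, so no integral changes. *)

(** * Inequalities for real powers *)

Section real_powers.
Context {R : realType}.
Implicit Types a b c p r t u x y : R.

(** Young's inequality for the conjugate exponents p and p / (p - 1), with
    denominators cleared. The next two lemmas are its instances b = 1 and
    b = a + t. *)
Lemma young_powR a b p : 0 <= a -> 0 <= b -> 1 < p ->
  p * (a * b `^ (p - 1)) <= a `^ p + (p - 1) * b `^ p.
Proof.
move=> a0 b0 p1; have p0 : 0 < p by lra.
have pB1 : p - 1 != 0 by apply/eqP; lra.
have q0 : 0 < p / (p - 1) by rewrite divr_gt0//; lra.
have pq : p^-1 + (p / (p - 1))^-1 = 1.
  by rewrite invf_div; field; rewrite gt_eqF.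
have := conjugate_powR a0 (powR_ge0 b (p - 1)) p0 q0 pq.
rewrite -powRrM (_ : (p - 1) * (p / (p - 1)) = p); last by field.
rewrite -(ler_pM2l p0) => /le_trans; apply.
rewrite le_eqVlt; apply/orP; left; apply/eqP; field.
by rewrite pB1 gt_eqF.
Qed.

Lemma bernoulli_powR u p : 0 <= u -> 1 < p -> 1 + p * u <= (1 + u) `^ p.
Proof.
move=> u0 p1; have := @young_powR (1 + u) 1 p _ ler01 p1.
by rewrite !powR1 => /(_ ltac:(lra)); lra.
Qed.

(** The convex function x^p lies above its tangent at a + t; this is that
    inequality read at the point a. *)
Lemma powRD_le_tangent a t p : 0 <= a -> 0 <= t -> 1 < p ->
  (a + t) `^ p <= a `^ p + p * t * (a + t) `^ (p - 1).
Proof.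
move=> a0 t0 p1; have at0 : 0 <= a + t by lra.
have := @young_powR a (a + t) p a0 at0 p1.
have := @mulr_powRB1 _ (a + t) p at0 ltac:(lra).
by move=> <-; nra.
Qed.

(** Right continuity of the power function, without limits: taking r-th roots
    turns the hypothesis into a comparison with a + 1 / (k + 1). *)
Lemma le_powR_limit a c r y : 0 <= a -> 0 <= c -> 0 < r ->
  (forall k : nat, y <= c * (a + k.+1%:R^-1) `^ r) -> y <= c * a `^ r.
Proof.
move=> a0 + r0 H; rewrite le_eqVlt => /predU1P[c0|c0].
  by have := H 0; rewrite -c0 !mul0r.
rewrite mulrC -ler_pdivrMr//.
have [y0|y0] := leP y 0.
  by rewrite (le_trans _ (powR_ge0 _ _))// mulr_le0_ge0// invr_ge0 ltW.
have w0 : 0 <= y / c by rewrite divr_ge0 ?ltW.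
suff : (y / c) `^ r^-1 <= a.
  move=> /(ge0_ler_powR (ltW r0)); rewrite !nnegrE powR_ge0 => /(_ isT a0).
  by rewrite -powRrM mulVf ?gt_eqF// powRr1.
apply/ler_addgt0Pr => e e0.
have [k ke] : exists k : nat, k.+1%:R^-1 < e.
  by have [k _ /(_ k (leqnn k))] := near_infty_natSinv_lt (PosNum e0); exists k.
apply: (@le_trans _ _ (a + k.+1%:R^-1)); last by rewrite lerD2l ltW.
have ak0 : 0 <= a + k.+1%:R^-1 by rewrite addr_ge0.
have -> : a + k.+1%:R^-1 = ((a + k.+1%:R^-1) `^ r) `^ r^-1.
  by rewrite -powRrM mulfV ?gt_eqF// powRr1.
apply: ge0_ler_powR; rewrite ?nnegrE ?powR_ge0//.
  by rewrite invr_ge0 ltW.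
by rewrite ler_pdivrMr// mulrC.
Qed.

End real_powers.

(** * Extremizers of a linear functional on the unit sphere of L^p *)

Section extremizer.
Context d (T : measurableType d) (R : realType).
Local Open Scope ereal_scope.

Lemma ge0_Lfun_normE {mu : {measure set T -> \bar R}} {p : R} {f : T -> R} :
  (1 < p)%R -> f \in Lfun mu p%:E -> (forall x, 0 <= f x)%R ->
  exists2 s : R, (0 <= s)%R &
    'N[mu]_p%:E[EFin \o f] = s%:E /\ \int[mu]_x (f x `^ p)%:E = (s `^ p)%:E.
Proof.
move=> p1 fLp f0.
have Nfin : 'N[mu]_p%:E[EFin \o f] \is a fin_num.
  rewrite ge0_fin_numE; last exact: Lnorm_ge0.
  by have := sub_Lfun_finLfun fLp; rewrite inE.
pose s := fine ('N[mu]_p%:E[EFin \o f]).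
exists s; first exact/fine_ge0/Lnorm_ge0.
rewrite /s fineK//; split=> //.
have pN0 : p != 0%R by rewrite gt_eqF// (lt_trans _ p1).
have := poweR_Lnorm mu (EFin \o f) pN0; rewrite -(fineK Nfin) poweR_EFin => ->.
by apply: eq_integral => x _; rewrite /= ger0_norm.
Qed.

Lemma Lfun_measurable {mu : {measure set T -> \bar R}} {p} {f : T -> R} :
  f \in Lfun mu p -> measurable_fun setT f.
Proof. by move=> /sub_Lfun_mfun; rewrite inE. Qed.

Definition nonneg_unit_sphere (mu : {measure set T -> \bar R}) (p : R) :=
  [set h : T -> R | [/\ h \in Lfun mu p%:E, forall x, (0 <= h x)%R &
                        'N[mu]_p%:E[EFin \o h] = 1]].

Lemma normr_nonneg_unit_sphere (mu : {measure set T -> \bar R}) (p : R)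
    (f : T -> R) : f \in Lfun mu p%:E -> 'N[mu]_p%:E[EFin \o f] = 1 ->
  nonneg_unit_sphere mu p (Num.norm \o f).
Proof.
move=> fLp fN.
have NE : 'N[mu]_p%:E[EFin \o (Num.norm \o f)] = 1.
  by rewrite -fN -[RHS]Lnorm_abse.
split=> //; last by move=> x /=.
rewrite inE; apply/andP; split; rewrite inE/=.
  by apply: measurableT_comp => //; exact: Lfun_measurable fLp.
by rewrite /finite_norm NE ltry.
Qed.

Section test_function.
Variables (mu : {measure set T -> \bar R}) (p : R) (c : R).
Variables (g : T -> \bar R) (f : T -> R).
Hypotheses (p1 : (1 < p)%R).
Hypotheses (mg : measurable_fun setT g) (g0 : forall x, 0 <= g x).
Hypothesis fS : nonneg_unit_sphere mu p f.
Hypothesis fg_max : forall h, nonneg_unit_sphere mu p h ->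
  \int[mu]_x ((h x)%:E * g x) <= c%:E.
Hypothesis fg : \int[mu]_x ((f x)%:E * g x) = c%:E.

Let fLp : f \in Lfun mu p%:E. Proof. by case: fS. Qed.
Let f0 x : (0 <= f x)%R. Proof. by case: fS. Qed.
Let fN : 'N[mu]_p%:E[EFin \o f] = 1. Proof. by case: fS. Qed.
Let mf : measurable_fun setT f. Proof. exact: Lfun_measurable fLp. Qed.

Let p0 : (0 < p)%R. Proof. exact: lt_trans p1. Qed.

Let fp1 : \int[mu]_x (f x `^ p)%:E = 1.
Proof.
have [s s0 [Ns ->]] := ge0_Lfun_normE p1 fLp f0.
by move: fN; rewrite Ns => -[->]; rewrite powR1.
Qed.

Let c0 : (0 <= c)%R.
Proof.
by rewrite -lee_fin -fg; apply: integral_ge0 => x _; rewrite mule_ge0// lee_fin.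
Qed.

(** Homogeneity extends the bound from the unit sphere to all nonnegative
    functions. *)
Lemma fg_max_scaled (h : T -> R) (s : R) : h \in Lfun mu p%:E ->
  (forall x, 0 <= h x)%R -> (0 < s)%R -> 'N[mu]_p%:E[EFin \o h] = s%:E ->
  \int[mu]_x ((h x)%:E * g x) <= (c * s)%:E.
Proof.
move=> hLp h0 s0 hN; have mh := Lfun_measurable hLp.
have p1' : 1 <= p%:E by rewrite lee_fin ltW.
pose k := (s^-1 \*o h)%R.
have kE : k = (s^-1 \o* h)%R by apply/funext => x; rewrite /k /= mulrC.
have kLp : k \in Lfun mu p%:E by rewrite kE; exact: Lfun_scale (ltW p1) hLp.
have k0 x : (0 <= k x)%R by rewrite /k /= mulr_ge0// invr_ge0 ltW.
have kN : 'N[mu]_p%:E[EFin \o k] = 1.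
  have := LnormZ (Lfun_Sub p1' hLp) s^-1.
  rewrite /= hN ger0_norm ?invr_ge0 ?(ltW s0)// => H.
  by apply: (etrans H); rewrite -EFinM mulVf// gt_eqF.
have -> : \int[mu]_x ((h x)%:E * g x) = s%:E * \int[mu]_x ((k x)%:E * g x).
  rewrite -ge0_integralZl//; last 3 first.
  - apply: emeasurable_funM => //; apply/measurable_EFinP.
    exact: Lfun_measurable kLp.
  - by move=> x _; rewrite mule_ge0// lee_fin.
  - by rewrite lee_fin ltW.
  apply: eq_integral => x _.
  by rewrite muleA -EFinM /k /= mulVKf// gt_eqF.
rewrite mulrC EFinM lee_pmul2l ?lte_fin//.
exact: fg_max.
Qed.

(** The first-order condition tested in the direction 1_F, for a finite step
    t. The competitor f + t 1_F, normalised, gives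
    c + t int_F g <= c ||f + t 1_F||_p, and the norm is at most 1 + t u with
    u = int_F (f + t)^(p-1). The finiteness of c u is recorded because
    [ae_le_of_integral_le] has to subtract it. *)
Lemma integral_le_test (t : R) (F : set T) : (0 < t)%R -> measurable F ->
  mu F < +oo ->
  \int[mu]_(x in F) (c * (f x + t) `^ (p - 1))%:E < +oo /\
  \int[mu]_(x in F) g x <= \int[mu]_(x in F) (c * (f x + t) `^ (p - 1))%:E.
Proof.
move=> t0 mF muF.
pose h : T -> R := (f \+ t \*o \1_F)%R.
have h0 x : (0 <= h x)%R by rewrite /h /= addr_ge0// mulr_ge0// ltW.
have FLp : (t \o* \1_F : T -> R)%R \in Lfun mu p%:E.
  apply: Lfun_scale; first exact: ltW.
  rewrite inE; apply/andP; split; rewrite inE//=.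
  rewrite /finite_norm unlock poweR_lty//.
  under eq_integral => x _.
    rewrite /= ger0_norm// (_ : _ `^ p = \1_F x)%R; last first.
      by rewrite indicE; case: (x \in F); rewrite ?powR1// powR0// gt_eqF.
    over.
  by rewrite integral_indic// setIT.
have hLp : h \in Lfun mu p%:E.
  rewrite (_ : h = f + (t \o* \1_F))%R; last first.
    by apply/funext => x; rewrite /h /= mulrC.
  by apply Lfun_addr_closed => //; rewrite lee_fin ltW.
have mh := Lfun_measurable hLp.
have mpow q : measurable_fun setT (fun x => ((f x + t) `^ q)%:E).
  apply/measurable_EFinP; apply: (measurableT_comp (measurable_powR _)).
  exact: measurable_funD.
have [s s0 [Ns hs]] := ge0_Lfun_normE p1 hLp h0.
pose U := \int[mu]_(x in F) ((f x + t) `^ (p - 1))%:E.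
have U0 : 0 <= U by apply: integral_ge0 => x _; rewrite lee_fin powR_ge0.
have hF x : F x -> h x = (f x + t)%R.
  by move=> Fx; rewrite /h /= indicE mem_set// mulr1.
have hNF x : ~ F x -> h x = f x.
  by move=> Fx; rewrite /h /= indicE memNset// mulr0 addr0.
(* Since f + t >= t, the integrand (f + t)^(p-1) is at most t^-1 (f + t)^p,
   and f + t agrees on F with an L^p function. *)
have Ufin : U < +oo.
  apply: (@le_lt_trans _ _ (\int[mu]_(x in F) (t^-1%:E * (h x `^ p)%:E))).
    apply: ge0_le_integral => //.
    - by move=> x _; rewrite lee_fin powR_ge0.
    - exact/measurable_funTS/mpow.
    - apply: measurable_funeM; apply: measurable_funTS; apply/measurable_EFinP.
      exact: (measurableT_comp (measurable_powR _)).
    move=> x Fx; rewrite hF// lee_fin mulrC ler_pdivlMr//.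
    rewrite -(@mulr_powRB1 _ (f x + t) p) ?addr_ge0// ?(ltW t0)//.
    by rewrite mulrC ler_wpM2r ?powR_ge0// lerDr.
  have mhp : measurable_fun setT (fun x => (h x `^ p)%:E).
    by apply/measurable_EFinP; exact: (measurableT_comp (measurable_powR _)).
  rewrite ge0_integralZl//; last 3 first.
  - exact/measurable_funTS/mhp.
  - by move=> x _; rewrite lee_fin powR_ge0.
  - by rewrite lee_fin invr_ge0 ltW.
  apply: (@le_lt_trans _ _ (t^-1%:E * \int[mu]_x (h x `^ p)%:E)).
    rewrite lee_pmul2l ?lte_fin ?invr_gt0//; apply: ge0_subset_integral => //.
    by move=> x _; rewrite lee_fin powR_ge0.
  by rewrite hs -EFinM ltry.
have UE : U = (fine U)%:E by rewrite fineK// ge0_fin_numE.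
have cUE : \int[mu]_(x in F) (c * (f x + t) `^ (p - 1))%:E = (c * fine U)%:E.
  rewrite EFinM -UE -ge0_integralZl//.
  - exact/measurable_funTS/mpow.
  - by move=> x _; rewrite lee_fin powR_ge0.
rewrite cUE ltry; split=> //.
have u0 : (0 <= fine U)%R by exact: fine_ge0.
set u := fine U in UE u0 *.
have normF (k : T -> \bar R) : \int[mu]_(x in F) k x =
    \int[mu]_x ((\1_F x)%:E * k x).
  rewrite integral_mkcond; apply: eq_integral => x _.
  by rewrite patchE indicE; case: (x \in F); rewrite ?mul1e ?mul0e.
have m1F : measurable_fun setT (fun x => (\1_F x : R)%:E).
  exact/measurable_EFinP.
(* Pointwise convexity, integrated; off F both sides are f^p. *)
have hs_le : (s `^ p <= 1 + p * t * u)%R.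
  rewrite -lee_fin -hs EFinD -fp1 EFinM -UE /U normF.
  rewrite -ge0_integralZl//; last 3 first.
  - exact: emeasurable_funM.
  - by move=> x _; rewrite mule_ge0// lee_fin powR_ge0.
  - by rewrite lee_fin mulr_ge0// ltW.
  rewrite -ge0_integralD//; last 4 first.
  - by move=> x _; rewrite lee_fin powR_ge0.
  - by apply/measurable_EFinP; exact: (measurableT_comp (measurable_powR _)).
  - move=> x _; rewrite mule_ge0// ?mule_ge0// lee_fin ?powR_ge0//.
    by rewrite mulr_ge0// ltW.
  - by apply: measurable_funeM; exact: emeasurable_funM.
  apply: ge0_le_integral => //.
  - by move=> x _; rewrite lee_fin powR_ge0.
  - by apply/measurable_EFinP; exact: (measurableT_comp (measurable_powR _)).
  - apply: emeasurable_funD.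
      by apply/measurable_EFinP; exact: (measurableT_comp (measurable_powR _)).
    by apply: measurable_funeM; exact: emeasurable_funM.
  move=> x _; rewrite -!EFinM -EFinD lee_fin.
  have [Fx|Fx] := pselect (F x).
    by rewrite hF// indicE mem_set// mul1r powRD_le_tangent// ltW.
  by rewrite hNF// indicE memNset// mul0r mulr0 addr0.
have s1 : (1 <= s)%R.
  have /ge0_ler_powR : (0 <= p^-1)%R by rewrite invr_ge0 ltW.
  move=> /(_ 1%R (s `^ p)%R); rewrite !nnegrE ler01 powR_ge0 => /(_ isT isT).
  rewrite powR1 -powRrM mulfV ?gt_eqF// powRr1//; apply.
  rewrite -lee_fin -hs -fp1; apply: ge0_le_integral => //.
  - by move=> x _; rewrite lee_fin powR_ge0.
  - by apply/measurable_EFinP; exact: (measurableT_comp (measurable_powR _)).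
  - by apply/measurable_EFinP; exact: (measurableT_comp (measurable_powR _)).
  move=> x _; rewrite lee_fin; apply: ge0_ler_powR; rewrite ?nnegrE// ?(ltW p0)//.
  by rewrite /h /= lerDl mulr_ge0// ltW.
have stu : (s <= 1 + t * u)%R.
  have tu0 : (0 <= t * u)%R by rewrite mulr_ge0// ltW.
  rewrite leNgt; apply/negP => ltus.
  have := @gt0_ltr_powR _ p p0 (1 + t * u)%R s; rewrite !nnegrE.
  rewrite addr_ge0// s0 => /(_ isT isT ltus).
  apply/negP; rewrite -leNgt (le_trans hs_le)//.
  by rewrite -mulrA; exact: bernoulli_powR.
have := @fg_max_scaled h s hLp h0 (lt_le_trans ltr01 s1) Ns.
have -> : \int[mu]_x ((h x)%:E * g x) = c%:E + t%:E * \int[mu]_(x in F) g x.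
  rewrite normF -fg -ge0_integralZl//; last 3 first.
  - exact: emeasurable_funM.
  - by move=> x _; rewrite mule_ge0// lee_fin.
  - by rewrite lee_fin ltW.
  rewrite -ge0_integralD//; last 4 first.
  - by move=> x _; rewrite mule_ge0// lee_fin.
  - by apply: emeasurable_funM => //; exact/measurable_EFinP.
  - by move=> x _; rewrite mule_ge0// ?mule_ge0// lee_fin ltW.
  - by apply: measurable_funeM; exact: emeasurable_funM.
  apply: eq_integral => x _; rewrite /h /= EFinD EFinM muleA ge0_muleDl//.
    by rewrite lee_fin.
  by rewrite mule_ge0// lee_fin ltW.
move=> H.
have : c%:E + t%:E * \int[mu]_(x in F) g x <= c%:E + t%:E * (c * u)%:E.
  apply: (le_trans H); rewrite -EFinM -EFinD lee_fin.
  by have := ler_wpM2l c0 stu; lra.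
by rewrite leeD2lE// lee_pmul2l// lte_fin.
Qed.

End test_function.

(** The set where k < g meets each piece of finite measure in a set F on which
    int_F (g - k) <= 0, the subtraction being legitimate because int_F k is
    finite; so F is null. *)
Lemma ae_le_of_integral_le (mu : {sigma_finite_measure set T -> \bar R})
    (g k : T -> \bar R) :
  measurable_fun setT g -> measurable_fun setT k ->
  (forall x, 0 <= g x) -> (forall x, 0 <= k x) ->
  (forall F, measurable F -> mu F < +oo ->
    \int[mu]_(x in F) k x < +oo /\
    \int[mu]_(x in F) g x <= \int[mu]_(x in F) k x) ->
  {ae mu, forall x, g x <= k x}.
Proof.
move=> mg mk g0 k0 H.
have /sigma_finiteP[E [ET _ Eoo]] := sigma_finiteT mu.
suff HE j : {ae mu, forall x, E j x -> g x <= k x}.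
  have := ae_foralln HE; apply: filterS => x Hx.
  have : [set: T] x by [].
  by rewrite ET => -[j _]; exact: Hx.
have [mE Efin] := Eoo j.
pose F := E j `&` [set x | k x < g x].
have mF : measurable F.
  exact: measurable_lte (measurable_funTS mk) (measurable_funTS mg).
have muF : mu F < +oo.
  by apply: le_lt_trans Efin; rewrite le_measure ?inE//; exact: subIsetl.
have [kfin gk] := H F mF muF.
have kint : \int[mu]_(x in F) k x \is a fin_num.
  by rewrite ge0_fin_numE//; exact: integral_ge0.
have kx x : F x -> k x \is a fin_num.
  by move=> [_ /= kg]; rewrite ge0_fin_numE// (lt_le_trans kg)// leey.
have gDk : \int[mu]_(x in F) g x =
    \int[mu]_(x in F) k x + \int[mu]_(x in F) `|g x - k x|.
  rewrite -ge0_integralD//; last 2 first.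
  - exact: measurable_funTS.
  - apply: measurableT_comp => //; apply: measurable_funTS.
    exact: emeasurable_funB.
  apply: eq_integral => x; rewrite inE => Fx; have [_ /= kg] := Fx.
  by rewrite gee0_abs ?sube_ge0 ?kx// ?ltW// addeC subeK// kx.
have : \int[mu]_(x in F) `|g x - k x| = 0.
  apply/eqP; rewrite eq_le integral_ge0 ?andbT//.
  by move: gk; rewrite gDk -leeBrDl// subee.
move=> /ae_eq_integral_abs => /(_ mF (measurable_funTS (emeasurable_funB mg mk))).
apply: filterS => x HF Ex; rewrite leNgt; apply/negP => kg.
have Fx : F x by [].
have gkx : g x = k x by rewrite -(subeK (g x) (kx x Fx)) (HF Fx) add0e.
by move: kg; rewrite gkx ltxx.
Qed.

(** The equality case of Hölder's inequality in variational form. *)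
Lemma extremizer_dual (mu : {sigma_finite_measure set T -> \bar R}) (p c : R)
    (g : T -> \bar R) (f : T -> R) : (1 < p)%R ->
  measurable_fun setT g -> (forall x, 0 <= g x) ->
  nonneg_unit_sphere mu p f ->
  (forall h, nonneg_unit_sphere mu p h ->
    \int[mu]_x ((h x)%:E * g x) <= c%:E) ->
  \int[mu]_x ((f x)%:E * g x) = c%:E ->
  {ae mu, forall x, c%:E * (f x `^ (p - 1))%:E = g x}.
Proof.
move=> p1 mg g0 fS fg_max fg; have [fLp f0 fN] := fS.
have mf : measurable_fun setT f := Lfun_measurable fLp.
have c0 : (0 <= c)%R.
  by rewrite -lee_fin -fg; apply: integral_ge0 => x _; rewrite mule_ge0// lee_fin.
have p10 : (0 < p - 1)%R by lra.
pose k x := (c * f x `^ (p - 1))%:E.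
have k0 x : 0 <= k x by rewrite lee_fin mulr_ge0// powR_ge0.
have mk : measurable_fun setT k.
  apply/measurable_EFinP; apply: measurable_funM => //.
  exact: (measurableT_comp (measurable_powR _)).
have gk : {ae mu, forall x, g x <= k x}.
  have gt (j : nat) :
      {ae mu, forall x, g x <= (c * (f x + j.+1%:R^-1) `^ (p - 1))%:E}.
    apply: ae_le_of_integral_le => //.
    - apply/measurable_EFinP; apply: measurable_funM => //.
      apply: (measurableT_comp (measurable_powR _)).
      exact: measurable_funD.
    - by move=> x; rewrite lee_fin mulr_ge0// powR_ge0.
    - by move=> F mF muF; apply: (@integral_le_test mu p c g f).
  have := ae_foralln gt; apply: filterS => x gx.
  have gfin : g x \is a fin_num.
    by rewrite ge0_fin_numE// (le_lt_trans (gx 0%N))// ltry.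
  rewrite -(fineK gfin) /k lee_fin; apply: le_powR_limit => // j.
  by rewrite -lee_fin fineK.
(* Truncating g at k changes it on a null set only, and makes k - g' finite
   and nonnegative everywhere. *)
pose g' x := mine (g x) (k x).
have gg' : {ae mu, forall x, g' x = g x}.
  by apply: filterS gk => x gx; rewrite /g' min_l.
have mg' : measurable_fun setT g' by exact: measurable_mine.
have g'0 x : 0 <= g' x by rewrite /g' le_min g0 k0.
have g'k x : g' x <= k x by rewrite /g' ge_min lexx orbT.
have g'fin x : g' x \is a fin_num.
  by rewrite ge0_fin_numE// (le_lt_trans (g'k x))// ltry.
have mfE : measurable_fun setT (EFin \o f) by exact/measurable_EFinP.
have fg' : \int[mu]_x ((f x)%:E * g' x) = c%:E.
  rewrite -fg; apply: ge0_ae_eq_integral => //.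
  - exact: emeasurable_funM.
  - exact: emeasurable_funM.
  - by move=> x _; rewrite mule_ge0// lee_fin.
  - by move=> x _; rewrite mule_ge0// lee_fin.
  - by apply: filterS gg' => x ->.
have fk : \int[mu]_x ((f x)%:E * k x) = c%:E.
  have [s s0 [Ns fs]] := ge0_Lfun_normE p1 fLp f0.
  have s1 : s = 1%R by move: fN; rewrite Ns => -[].
  rewrite -[RHS]mule1 -[X in _ * X](_ : (s `^ p)%:E = 1); last first.
    by rewrite s1 powR1.
  rewrite -fs -ge0_integralZl//.
  - apply: eq_integral => x _; rewrite /k -!EFinM; congr EFin.
    by rewrite mulrCA mulr_powRB1// (lt_trans _ p1).
  - apply/measurable_EFinP; exact: (measurableT_comp (measurable_powR _)).
  - by move=> x _; rewrite lee_fin powR_ge0.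
have mkg' : measurable_fun setT (fun x => (f x)%:E * (k x - g' x)).
  by apply: emeasurable_funM => //; exact: emeasurable_funB.
have kg'0 x : 0 <= (f x)%:E * (k x - g' x).
  apply: mule_ge0; first by rewrite lee_fin.
  by rewrite sube_ge0 ?g'fin// g'k.
(* Both f g' and f k = c f^p integrate to c. *)
have : \int[mu]_x `|(f x)%:E * (k x - g' x)| = 0.
  have : c%:E = c%:E + \int[mu]_x `|(f x)%:E * (k x - g' x)|.
    rewrite -[X in _ = X + _]fg' -ge0_integralD//; last 3 first.
    - by move=> x _; rewrite mule_ge0// lee_fin.
    - exact: emeasurable_funM.
    - exact: measurableT_comp.
    rewrite -fk; apply: eq_integral => x _; rewrite gee0_abs//.
    by rewrite -(fineK (g'fin x)) /k -!EFinM -EFinD; congr EFin; ring.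
  move=> /(congr1 (fun y => y - c%:E)) /=.
  by rewrite subee// [c%:E + _]addeC addeK// => <-.
move=> /ae_eq_integral_abs => /(_ measurableT mkg') fkg'.
apply: filterS2 fkg' gg' => x /(_ I) /= + gx.
rewrite -gx => /eqP; rewrite mule_eq0 => /orP[|].
  (* where f vanishes, k vanishes too because p > 1, and g' <= k *)
  rewrite eqe => /eqP fx0; apply/eqP; rewrite eq_le -EFinM.
  have kx0 : (c * f x `^ (p - 1) = 0)%R by rewrite fx0 powR0 ?mulr0// gt_eqF.
  by rewrite kx0 g'0 /= -[leRHS]/(0%:E) -kx0 g'k.
by move=> /eqP kg'; rewrite -EFinM -/(k x) -(subeK (k x) (g'fin x)) kg' add0e.
Qed.

End extremizer.
Arguments Lfun_measurable {d T R mu p f} _.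
Arguments nonneg_unit_sphere {d T R} mu p _.
Arguments extremizer_dual {d T R} mu p c g f.

(** * Sigma-finite products and triple integrals *)

Section product_sigma_finite.
Context d1 d2 (T1 : measurableType d1) (T2 : measurableType d2) (R : realType).
Variables (m1 : {sigma_finite_measure set T1 -> \bar R})
          (m2 : {sigma_finite_measure set T2 -> \bar R}).

(** A name for the product measure, so that sigma-finiteness can be attached to
    it: Tonelli's theorem will be applied with one factor a product. *)
Definition sigma_finite_product : set (T1 * T2) -> \bar R := (m1 \x m2)%E.

HB.instance Definition _ := Measure.on sigma_finite_product.
HB.instance Definition _ := Measure_isSigmaFinite.Build _ _ _
  sigma_finite_product (product_measure_sigma_finite m1 m2).

Local Open Scope ereal_scope.

Lemma ae_fst (P : T1 -> Prop) :
  {ae m1, forall x, P x} -> {ae (m1 \x m2), forall z, P z.1}.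
Proof.
move=> [N [mN N0 PN]]; exists (N `*` setT); split.
- exact: measurableX.
- by rewrite product_measure1E// [X in X * _]N0 mul0e.
- by move=> z Pz; split => //; apply: PN.
Qed.

Lemma ae_snd (P : T2 -> Prop) :
  {ae m2, forall x, P x} -> {ae (m1 \x m2), forall z, P z.2}.
Proof.
move=> [N [mN N0 PN]]; exists (setT `*` N); split.
- exact: measurableX.
- by rewrite product_measure1E// [X in _ * X]N0 mule0.
- by move=> z Pz; split => //; apply: PN.
Qed.

End product_sigma_finite.
Arguments ae_fst {d1 d2 T1 T2 R} m1 m2 {P}.
Arguments ae_snd {d1 d2 T1 T2 R} m1 m2 {P}.
Arguments sigma_finite_product {d1 d2 T1 T2 R} m1 m2 _.

Section ae_eq_products.
Context d1 d2 d3 (T1 : measurableType d1) (T2 : measurableType d2)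
  (T3 : measurableType d3) (R : realType).
Variables (m1 : {sigma_finite_measure set T1 -> \bar R})
          (m2 : {sigma_finite_measure set T2 -> \bar R})
          (m3 : {sigma_finite_measure set T3 -> \bar R}).

Lemma ae_eq_pair_integral (k : T1 * T2 -> R) (u u' : T1 -> R) (v v' : T2 -> R) :
  measurable_fun setT k ->
  measurable_fun setT u -> measurable_fun setT u' ->
  measurable_fun setT v -> measurable_fun setT v' ->
  {ae m1, forall x, u x = u' x} -> {ae m2, forall x, v x = v' x} ->
  (\int[m1 \x m2]_z (k z * u z.1 * v z.2)%:E =
   \int[m1 \x m2]_z (k z * u' z.1 * v' z.2)%:E)%E.
Proof.
move=> mk mu mu' mv mv' uu vv.
have mint (f : T1 -> R) (g : T2 -> R) :
    measurable_fun setT f -> measurable_fun setT g ->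
    measurable_fun setT (fun z : T1 * T2 => (k z * f z.1 * g z.2)%:E).
  move=> mf mg; apply/measurable_EFinP.
  apply: measurable_funM; last exact: measurableT_comp.
  by apply: measurable_funM => //; exact: measurableT_comp.
apply: ae_eq_integral; [by []|exact: mint..|].
by apply: filterS2 (ae_fst _ _ uu) (ae_snd _ _ vv) => z -> ->.
Qed.

Lemma ae_eq_triple_integral (k : T1 * T2 * T3 -> R)
    (u u' : T1 -> R) (v v' : T2 -> R) (w w' : T3 -> R) :
  measurable_fun setT k ->
  measurable_fun setT u -> measurable_fun setT u' ->
  measurable_fun setT v -> measurable_fun setT v' ->
  measurable_fun setT w -> measurable_fun setT w' ->
  {ae m1, forall x, u x = u' x} -> {ae m2, forall x, v x = v' x} ->
  {ae m3, forall x, w x = w' x} ->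
  (\int[(m1 \x m2) \x m3]_z (k z * u z.1.1 * v z.1.2 * w z.2)%:E =
   \int[(m1 \x m2) \x m3]_z (k z * u' z.1.1 * v' z.1.2 * w' z.2)%:E)%E.
Proof.
move=> mk mu mu' mv mv' mw mw' uu vv ww.
have mint (f : T1 -> R) (g : T2 -> R) (h : T3 -> R) :
    measurable_fun setT f -> measurable_fun setT g -> measurable_fun setT h ->
    measurable_fun setT
      (fun z : T1 * T2 * T3 => (k z * f z.1.1 * g z.1.2 * h z.2)%:E).
  move=> mf mg mh; apply/measurable_EFinP.
  apply: measurable_funM; last exact: measurableT_comp.
  apply: measurable_funM; last first.
    exact: (measurableT_comp mg (measurableT_comp measurable_snd measurable_fst)).
  apply: measurable_funM => //.
  exact: (measurableT_comp mf (measurableT_comp measurable_fst measurable_fst)).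
apply: ae_eq_integral; [by []|exact: mint..|].
pose m12 : {sigma_finite_measure set (T1 * T2)%type -> \bar R} :=
  sigma_finite_product m1 m2.
have uu1 := ae_fst m12 m3 (ae_fst m1 m2 uu).
have vv1 := ae_fst m12 m3 (ae_snd m1 m2 vv).
by apply: filterS3 uu1 vv1 (ae_snd m12 m3 ww) => z -> -> ->.
Qed.

End ae_eq_products.

Section triple_tonelli.
Context d1 d2 d3 (T1 : measurableType d1) (T2 : measurableType d2)
  (T3 : measurableType d3) (R : realType).
Variables (m1 : {sigma_finite_measure set T1 -> \bar R})
          (m2 : {sigma_finite_measure set T2 -> \bar R})
          (m3 : {sigma_finite_measure set T3 -> \bar R}).
Local Open Scope ereal_scope.
Variable J : (T1 * T2) * T3 -> \bar R.
Hypotheses (mJ : measurable_fun setT J) (J0 : forall z, 0 <= J z).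

Let m12 : {sigma_finite_measure set (T1 * T2)%type -> \bar R} :=
  sigma_finite_product m1 m2.

Lemma triple_tonelli1 : \int[(m1 \x m2) \x m3]_z J z =
  \int[m1]_x \int[m2 \x m3]_w J ((x, w.1), w.2).
Proof.
rewrite (@fubini_tonelli1 _ _ _ _ _ m12 m3)//.
rewrite (@fubini_tonelli1 _ _ _ _ _ m1 m2)//; last 2 first.
- exact: measurable_fun_fubini_tonelli_F.
- by move=> x; exact: integral_ge0.
apply: eq_integral => x _; rewrite fubini_tonelli1//.
apply: measurableT_comp => //; apply: measurable_fun_pair => //.
exact: measurable_fun_pair.
Qed.

Lemma triple_tonelli2 : \int[(m1 \x m2) \x m3]_z J z =
  \int[m2]_x \int[m1 \x m3]_w J ((w.1, x), w.2).
Proof.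
rewrite (@fubini_tonelli1 _ _ _ _ _ m12 m3)//.
rewrite (@fubini_tonelli2 _ _ _ _ _ m1 m2)//; last 2 first.
- exact: measurable_fun_fubini_tonelli_F.
- by move=> x; exact: integral_ge0.
apply: eq_integral => x _; rewrite fubini_tonelli1//.
apply: measurableT_comp => //; apply: measurable_fun_pair => //.
exact: measurable_fun_pair.
Qed.

Lemma triple_tonelli3 : \int[(m1 \x m2) \x m3]_z J z =
  \int[m3]_x \int[m1 \x m2]_w J (w, x).
Proof. by rewrite (@fubini_tonelli2 _ _ _ _ _ m12 m3). Qed.

End triple_tonelli.

(** * Extremizers of a trilinear form *)

(** Here g(x) = int J(x, y) dy: the shape in which the marginals of the
    trilinear form appear, the second variable being a pair. *)
Lemma kernel_extremizer d d' (T : measurableType d) (S : measurableType d')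
    (R : realType) (m : {sigma_finite_measure set T -> \bar R})
    (nu : {sigma_finite_measure set S -> \bar R}) (p c : R)
    (J : T -> S -> R) (f : T -> R) : 1 < p ->
  measurable_fun setT (fun z : T * S => J z.1 z.2) ->
  (forall x y, 0 <= J x y) -> nonneg_unit_sphere m p f ->
  (forall h, nonneg_unit_sphere m p h ->
    \int[m]_x \int[nu]_y (h x * J x y)%:E <= c%:E)%E ->
  (\int[m]_x \int[nu]_y (f x * J x y)%:E = c%:E)%E ->
  {ae m, forall x, (c%:E * (f x `^ (p - 1))%:E = \int[nu]_y (J x y)%:E)%E}.
Proof.
move=> p1 mJ J0 fS Jle Jf.
have mJE : measurable_fun setT (fun z : T * S => (J z.1 z.2)%:E).
  exact/measurable_EFinP.
have intE h : nonneg_unit_sphere m p h ->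
    (\int[m]_x ((h x)%:E * \int[nu]_y (J x y)%:E) =
     \int[m]_x \int[nu]_y (h x * J x y)%:E)%E.
  move=> [_ h0 _]; apply: eq_integral => x _; rewrite -ge0_integralZl//.
  - exact: (measurable_fun_pair2 _ mJE).
  - by move=> y _; rewrite lee_fin.
  - by rewrite lee_fin.
apply: (extremizer_dual m p c (fun x => \int[nu]_y (J x y)%:E)%E f) => //.
- apply: (measurable_fun_fubini_tonelli_F _ mJE) => z.
  by rewrite /= lee_fin.
- by move=> x; apply: integral_ge0 => y _; rewrite lee_fin.
- by move=> h hS; rewrite intE//; exact: Jle.
- by rewrite intE.
Qed.

Section trilinear_extremizer.
Context d1 d2 d3 (T1 : measurableType d1) (T2 : measurableType d2)
  (T3 : measurableType d3) (R : realType).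
Variables (m1 : {sigma_finite_measure set T1 -> \bar R})
          (m2 : {sigma_finite_measure set T2 -> \bar R})
          (m3 : {sigma_finite_measure set T3 -> \bar R}).
Local Open Scope ereal_scope.
Variables (K : T1 -> T2 -> T3 -> R) (p1 p2 p3 c : R).
Variables (f1 : T1 -> R) (f2 : T2 -> R) (f3 : T3 -> R).
Hypotheses (K0 : forall x1 x2 x3, (0 <= K x1 x2 x3)%R).
Hypothesis mK : measurable_fun setT
  (fun z : (T1 * T2 * T3)%type => K z.1.1 z.1.2 z.2).
Hypotheses (p1_gt1 : (1 < p1)%R) (p2_gt1 : (1 < p2)%R) (p3_gt1 : (1 < p3)%R).

Let Lambda h1 h2 h3 := \int[(m1 \x m2) \x m3]_z
  (K z.1.1 z.1.2 z.2 * h1 z.1.1 * h2 z.1.2 * h3 z.2)%:E.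

Hypotheses (f1S : nonneg_unit_sphere m1 p1 f1) (f2S : nonneg_unit_sphere m2 p2 f2)
  (f3S : nonneg_unit_sphere m3 p3 f3).
Hypothesis Lambda_le : forall h1 h2 h3, nonneg_unit_sphere m1 p1 h1 ->
  nonneg_unit_sphere m2 p2 h2 -> nonneg_unit_sphere m3 p3 h3 ->
  Lambda h1 h2 h3 <= c%:E.
Hypothesis Lambda_max : Lambda f1 f2 f3 = c%:E.

Let mh1 {h} : nonneg_unit_sphere m1 p1 h ->
  measurable_fun setT (fun z : (T1 * T2 * T3)%type => h z.1.1).
Proof.
move=> [/Lfun_measurable mh _ _]; apply: measurableT_comp => //.
exact: measurableT_comp.
Qed.

Let mh2 {h} : nonneg_unit_sphere m2 p2 h ->
  measurable_fun setT (fun z : (T1 * T2 * T3)%type => h z.1.2).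
Proof.
move=> [/Lfun_measurable mh _ _]; apply: measurableT_comp => //.
exact: measurableT_comp.
Qed.

Let mh3 {h} : nonneg_unit_sphere m3 p3 h ->
  measurable_fun setT (fun z : (T1 * T2 * T3)%type => h z.2).
Proof. by move=> [/Lfun_measurable mh _ _]; exact: measurableT_comp. Qed.

Let mint h1 h2 h3 : nonneg_unit_sphere m1 p1 h1 ->
  nonneg_unit_sphere m2 p2 h2 -> nonneg_unit_sphere m3 p3 h3 ->
  measurable_fun setT (fun z : (T1 * T2 * T3)%type =>
    (K z.1.1 z.1.2 z.2 * h1 z.1.1 * h2 z.1.2 * h3 z.2)%:E).
Proof.
move=> h1S h2S h3S; apply/measurable_EFinP.
apply: measurable_funM (mh3 h3S); apply: measurable_funM (mh2 h2S).
exact: measurable_funM (mh1 h1S).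
Qed.

Let int_ge0 h1 h2 h3 : nonneg_unit_sphere m1 p1 h1 ->
  nonneg_unit_sphere m2 p2 h2 -> nonneg_unit_sphere m3 p3 h3 ->
  forall z : (T1 * T2 * T3)%type,
    0 <= (K z.1.1 z.1.2 z.2 * h1 z.1.1 * h2 z.1.2 * h3 z.2)%:E.
Proof. by move=> [_ ? _] [_ ? _] [_ ? _] z; rewrite lee_fin !mulr_ge0. Qed.

Lemma trilinear_extremizer1 : {ae m1, forall x1,
  c%:E * (f1 x1 `^ (p1 - 1))%:E =
  \int[m2 \x m3]_z (K x1 z.1 z.2 * f2 z.1 * f3 z.2)%:E}.
Proof.
have [[_ f20 _] [_ f30 _]] := (f2S, f3S).
pose J x (w : (T2 * T3)%type) := (K x w.1 w.2 * f2 w.1 * f3 w.2)%R.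
have LE h : nonneg_unit_sphere m1 p1 h ->
    \int[m1]_x \int[m2 \x m3]_w (h x * J x w)%:E = Lambda h f2 f3.
  move=> hS; rewrite /Lambda triple_tonelli1; [|exact: mint|exact: int_ge0].
  apply: eq_integral => x _; apply: eq_integral => w _.
  by congr EFin; rewrite /J /=; ring.
apply: (@kernel_extremizer _ _ _ _ _ m1 (sigma_finite_product m2 m3) p1 c J f1)
  => //.
- apply: (measurableT_comp (measurable_funM
    (measurable_funM mK (mh2 f2S)) (mh3 f3S))
    (g := fun z : (T1 * (T2 * T3))%type => ((z.1, z.2.1), z.2.2))).
  apply: measurable_fun_pair; last exact: measurableT_comp.
  by apply: measurable_fun_pair => //; exact: measurableT_comp.
- by move=> x w; rewrite !mulr_ge0.
- by move=> h hS; rewrite LE//; exact: Lambda_le.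
- by rewrite LE.
Qed.

Lemma trilinear_extremizer2 : {ae m2, forall x2,
  c%:E * (f2 x2 `^ (p2 - 1))%:E =
  \int[m1 \x m3]_z (K z.1 x2 z.2 * f1 z.1 * f3 z.2)%:E}.
Proof.
have [[_ f10 _] [_ f30 _]] := (f1S, f3S).
pose J x (w : (T1 * T3)%type) := (K w.1 x w.2 * f1 w.1 * f3 w.2)%R.
have LE h : nonneg_unit_sphere m2 p2 h ->
    \int[m2]_x \int[m1 \x m3]_w (h x * J x w)%:E = Lambda f1 h f3.
  move=> hS; rewrite /Lambda triple_tonelli2; [|exact: mint|exact: int_ge0].
  apply: eq_integral => x _; apply: eq_integral => w _.
  by congr EFin; rewrite /J /=; ring.
apply: (@kernel_extremizer _ _ _ _ _ m2 (sigma_finite_product m1 m3) p2 c J f2)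
  => //.
- apply: (measurableT_comp (measurable_funM
    (measurable_funM mK (mh1 f1S)) (mh3 f3S))
    (g := fun z : (T2 * (T1 * T3))%type => ((z.2.1, z.1), z.2.2))).
  apply: measurable_fun_pair; last exact: measurableT_comp.
  by apply: measurable_fun_pair => //; exact: measurableT_comp.
- by move=> x w; rewrite !mulr_ge0.
- by move=> h hS; rewrite LE//; exact: Lambda_le.
- by rewrite LE.
Qed.

Lemma trilinear_extremizer3 : {ae m3, forall x3,
  c%:E * (f3 x3 `^ (p3 - 1))%:E =
  \int[m1 \x m2]_z (K z.1 z.2 x3 * f1 z.1 * f2 z.2)%:E}.
Proof.
have [[_ f10 _] [_ f20 _]] := (f1S, f2S).
pose J x (w : (T1 * T2)%type) := (K w.1 w.2 x * f1 w.1 * f2 w.2)%R.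
have LE h : nonneg_unit_sphere m3 p3 h ->
    \int[m3]_x \int[m1 \x m2]_w (h x * J x w)%:E = Lambda f1 f2 h.
  move=> hS; rewrite /Lambda triple_tonelli3; [|exact: mint|exact: int_ge0].
  apply: eq_integral => x _; apply: eq_integral => w _.
  by congr EFin; rewrite /J /=; ring.
apply: (@kernel_extremizer _ _ _ _ _ m3 (sigma_finite_product m1 m2) p3 c J f3)
  => //.
- apply: (measurableT_comp (measurable_funM
    (measurable_funM mK (mh1 f1S)) (mh2 f2S))
    (g := fun z : (T3 * (T1 * T2))%type => (z.2, z.1))).
  exact: measurable_fun_pair.
- by move=> x w; rewrite !mulr_ge0.
- by move=> h hS; rewrite LE//; exact: Lambda_le.
- by rewrite LE.
Qed.

End trilinear_extremizer.

(** * The kernel and the Euler-Lagrange system *)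

Section kernel.
Variables (R : realType) (n : nat) (A : exponents R).
Local Notation E := (Rn R n).

Lemma measurable_sqrt : measurable_fun setT (@Num.sqrt R).
Proof. by apply: continuous_measurable_fun; exact: sqrt_continuous. Qed.

Lemma measurable_enorm : measurable_fun setT (@enorm R n).
Proof.
apply: (measurableT_comp measurable_sqrt); apply: measurable_sum => i.
by apply: measurable_funX; exact: measurable_tnth.
Qed.

Lemma measurable_edist :
  measurable_fun setT (fun z : E * E => Defs.edist z.1 z.2).
Proof.
apply: (measurableT_comp measurable_sqrt); apply: measurable_sum => i.
apply: measurable_funX; apply: measurable_funB.
  exact: (measurableT_comp (measurable_tnth i) measurable_fst).
exact: (measurableT_comp (measurable_tnth i) measurable_snd).
Qed.

Lemma kernel_fun_ge0 (x1 x2 x3 : E) : 0 <= kernel_fun A x1 x2 x3.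
Proof. by rewrite !mulr_ge0// powR_ge0. Qed.

Lemma measurable_kernel_fun : measurable_fun setT
  (fun z : E * E * E => kernel_fun A z.1.1 z.1.2 z.2).
Proof.
have mN (g : E * E * E -> E) a : measurable_fun setT g ->
    measurable_fun setT (fun z => enorm (g z) `^ a).
  move=> mg; apply: (measurableT_comp (measurable_powR _)).
  exact: (measurableT_comp measurable_enorm).
have mD (g h : E * E * E -> E) a : measurable_fun setT g ->
    measurable_fun setT h ->
    measurable_fun setT (fun z => Defs.edist (g z) (h z) `^ a).
  move=> mg mh; apply: (measurableT_comp (measurable_powR _)).
  apply: (measurableT_comp measurable_edist (g := fun z => (g z, h z))).
  exact: measurable_fun_pair.
have m1 : measurable_fun setT (fun z : E * E * E => z.1.1).
  exact: measurableT_comp.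
have m2 : measurable_fun setT (fun z : E * E * E => z.1.2).
  exact: measurableT_comp.
have m3 : measurable_fun setT (fun z : E * E * E => z.2) := measurable_snd.
apply: measurable_funM.
  apply: measurable_funM (mN _ _ m3).
  exact: measurable_funM (mN _ _ m1) (mN _ _ m2).
apply: measurable_funM (mD _ _ _ m2 m3).
exact: measurable_funM (mD _ _ _ m1 m2) (mD _ _ _ m1 m3).
Qed.

End kernel.

Theorem proposition4p1 (R : realType) (n : nat) (p1 p2 p3 : R)
  (A : exponents R) (f1 f2 f3 : Rn R n -> R)
  (n_ge1 : (1 <= n)%N)
  (p1_gt1 : 1 < p1) (p2_gt1 : 1 < p2) (p3_gt1 : 1 < p3)
  (scaling : p1^-1 + p2^-1 + p3^-1 +
    (alpha1 A + alpha2 A + alpha3 A + alpha12 A + alpha13 A + alpha23 A) / n%:R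
    = 3)
  (sum_alpha_ge0 : 0 <= alpha1 A + alpha2 A + alpha3 A)
  (alpha12_lt : alpha12 A < n%:R)
  (alpha13_lt : alpha13 A < n%:R)
  (alpha23_lt : alpha23 A < n%:R)
  (alpha1_lt : alpha1 A < n%:R / conj_exponent p1)
  (alpha2_lt : alpha2 A < n%:R / conj_exponent p2)
  (alpha3_lt : alpha3 A < n%:R / conj_exponent p3)
  (alpha1_gt : n%:R / conj_exponent p1 < alpha1 A + (alpha12 A + alpha13 A))
  (alpha2_gt : n%:R / conj_exponent p2 < alpha2 A + (alpha12 A + alpha23 A))
  (alpha3_gt : n%:R / conj_exponent p3 < alpha3 A + (alpha13 A + alpha23 A))
  (sum_alphaij_lt : alpha12 A + alpha13 A + alpha23 A < 2 * n%:R)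
  (sum_p_ge1 : 1 <= p1^-1 + p2^-1 + p3^-1)
  (bounded : trilinear_bounded n A p1 p2 p3)
  (f1_Lp : f1 \in Lfun (lebesgue_Rn R n) p1%:E)
  (f2_Lp : f2 \in Lfun (lebesgue_Rn R n) p2%:E)
  (f3_Lp : f3 \in Lfun (lebesgue_Rn R n) p3%:E)
  (f1_ge0 : {ae lebesgue_Rn R n, forall x, 0 <= f1 x})
  (f2_ge0 : {ae lebesgue_Rn R n, forall x, 0 <= f2 x})
  (f3_ge0 : {ae lebesgue_Rn R n, forall x, 0 <= f3 x})
  (f1_norm : ('N[lebesgue_Rn R n]_p1%:E[EFin \o f1] = 1)%E)
  (f2_norm : ('N[lebesgue_Rn R n]_p2%:E[EFin \o f2] = 1)%E)
  (f3_norm : ('N[lebesgue_Rn R n]_p3%:E[EFin \o f3] = 1)%E)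
  (maximal : trilinear_form A f1 f2 f3 = best_constant n A p1 p2 p3) :
  [/\ {ae lebesgue_Rn R n, forall x1,
        (best_constant n A p1 p2 p3 * (f1 x1 `^ (p1 - 1))%:E =
         \int[lebesgue_Rn R n \x lebesgue_Rn R n]_z
           (kernel_fun A x1 z.1 z.2 * f2 z.1 * f3 z.2)%:E)%E},
      {ae lebesgue_Rn R n, forall x2,
        (best_constant n A p1 p2 p3 * (f2 x2 `^ (p2 - 1))%:E =
         \int[lebesgue_Rn R n \x lebesgue_Rn R n]_z
           (kernel_fun A z.1 x2 z.2 * f1 z.1 * f3 z.2)%:E)%E} &
      {ae lebesgue_Rn R n, forall x3,
        (best_constant n A p1 p2 p3 * (f3 x3 `^ (p3 - 1))%:E =
         \int[lebesgue_Rn R n \x lebesgue_Rn R n]_z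
           (kernel_fun A z.1 z.2 x3 * f1 z.1 * f2 z.2)%:E)%E}].
Proof.
set mu := lebesgue_Rn R n in bounded f1_Lp f2_Lp f3_Lp f1_ge0 f2_ge0 f3_ge0
  f1_norm f2_norm f3_norm *.
pose abs (f : Rn R n -> R) : Rn R n -> R := Num.norm \o f.
pose g1 := abs f1; pose g2 := abs f2; pose g3 := abs f3.
have g1S : nonneg_unit_sphere mu p1 g1 by exact: normr_nonneg_unit_sphere.
have g2S : nonneg_unit_sphere mu p2 g2 by exact: normr_nonneg_unit_sphere.
have g3S : nonneg_unit_sphere mu p3 g3 by exact: normr_nonneg_unit_sphere.
have fg1 : {ae mu, forall x, f1 x = g1 x}.
  by apply: filterS f1_ge0 => x ?; rewrite /g1 /abs /= ger0_norm.
have fg2 : {ae mu, forall x, f2 x = g2 x}.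
  by apply: filterS f2_ge0 => x ?; rewrite /g2 /abs /= ger0_norm.
have fg3 : {ae mu, forall x, f3 x = g3 x}.
  by apply: filterS f3_ge0 => x ?; rewrite /g3 /abs /= ger0_norm.
have mf1 : measurable_fun setT f1 := Lfun_measurable f1_Lp.
have mf2 : measurable_fun setT f2 := Lfun_measurable f2_Lp.
have mf3 : measurable_fun setT f3 := Lfun_measurable f3_Lp.
have [mg1 mg2 mg3] : [/\ measurable_fun setT g1, measurable_fun setT g2 &
    measurable_fun setT g3] by split; exact: measurableT_comp.
have K0 := @kernel_fun_ge0 R n A; have mK := measurable_kernel_fun R n A.
have form_fg : trilinear_form A f1 f2 f3 = trilinear_form A g1 g2 g3.
  exact: ae_eq_triple_integral mK _ _ _ _ _ _ fg1 fg2 fg3.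
have form_ge0 h1 h2 h3 : nonneg_unit_sphere mu p1 h1 ->
    nonneg_unit_sphere mu p2 h2 -> nonneg_unit_sphere mu p3 h3 ->
    (0 <= trilinear_form A h1 h2 h3)%E.
  move=> [_ h10 _] [_ h20 _] [_ h30 _]; apply: integral_ge0 => z _.
  by rewrite lee_fin; do 3 apply: mulr_ge0 => //; exact: K0.
have best_fin : best_constant n A p1 p2 p3 \is a fin_num.
  rewrite ge0_fin_numE; last by rewrite -maximal form_fg form_ge0.
  have [C boundC] := bounded; apply: (@le_lt_trans _ _ C%:E); last exact: ltry.
  apply: ge_ereal_sup => _ [h1 [h2 [h3 [[h1L h2L h3L] [N1 N2 N3 ->]]]]].
  by have := boundC h1 h2 h3 h1L h2L h3L; rewrite N1 N2 N3 !mule1.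
pose c := fine (best_constant n A p1 p2 p3).
have bestE : best_constant n A p1 p2 p3 = c%:E by rewrite /c fineK.
have form_le h1 h2 h3 : nonneg_unit_sphere mu p1 h1 ->
    nonneg_unit_sphere mu p2 h2 -> nonneg_unit_sphere mu p3 h3 ->
    (trilinear_form A h1 h2 h3 <= c%:E)%E.
  move=> h1S h2S h3S; have h0 := form_ge0 _ _ _ h1S h2S h3S.
  rewrite -bestE; apply: ereal_sup_ubound; exists h1, h2, h3.
  by case: h1S h2S h3S => ? _ ? [? _ ?] [? _ ?]; rewrite gee0_abs.
have form_max : trilinear_form A g1 g2 g3 = c%:E by rewrite -form_fg maximal.
have E1 := @trilinear_extremizer1 _ _ _ _ _ _ _ mu mu mu _ p1 p2 p3 c g1 g2 g3
  K0 mK p1_gt1 g1S g2S g3S form_le form_max.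
have E2 := @trilinear_extremizer2 _ _ _ _ _ _ _ mu mu mu _ p1 p2 p3 c g1 g2 g3
  K0 mK p2_gt1 g1S g2S g3S form_le form_max.
have E3 := @trilinear_extremizer3 _ _ _ _ _ _ _ mu mu mu _ p1 p2 p3 c g1 g2 g3
  K0 mK p3_gt1 g1S g2S g3S form_le form_max.
split.
- apply: filterS2 E1 fg1 => x e fx; rewrite bestE fx e.
  apply/esym/ae_eq_pair_integral => //.
  apply: (measurableT_comp mK (g := fun w => ((x, w.1), w.2))).
  apply: measurable_fun_pair; last exact: measurable_snd.
  by apply: measurable_fun_pair; [exact: measurable_cst|exact: measurable_fst].
- apply: filterS2 E2 fg2 => x e fx; rewrite bestE fx e.
  apply/esym/ae_eq_pair_integral => //.
  apply: (measurableT_comp mK (g := fun w => ((w.1, x), w.2))).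
  apply: measurable_fun_pair; last exact: measurable_snd.
  by apply: measurable_fun_pair; [exact: measurable_fst|exact: measurable_cst].
- apply: filterS2 E3 fg3 => x e fx; rewrite bestE fx e.
  apply/esym/ae_eq_pair_integral => //.
  apply: (measurableT_comp mK (g := fun w => ((w.1, w.2), x))).
  apply: measurable_fun_pair; last exact: measurable_cst.
  by apply: measurable_fun_pair; [exact: measurable_fst|exact: measurable_snd].
Qed.
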